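(* Let $a>0$ and let there be finitely many training environments $e=1,\dots,E$ with positive weights $w_e$ summing to one. If every training environment has mismatch probability $\delta_e=0$, then both $f_C$ and $f_S$ globally maximise the source objective $J_{\mathrm{tr}}$ over $\mathcal{F}$. At a target environment with mismatch probability $\delta_{\mathrm{te}}=1$, the source-optimal classifier $g$ on $f_S$ has error one: $\mathcal{L}_{\mathrm{te}}(g\circ f_S)=1$.
   Context: Environment model. For $\delta\in[0,1]$, $P_\delta$ is the law of $(\mathbf{X},Y)$ with $Y\sim\mathrm{Bernoulli}(1/2)$, $\mathbf{X}=(C,S)\in\{0,1\}^2$, $C=Y$, $S=Y\oplus B$ (exclusive-or), $B\sim\mathrm{Bernoulli}(\delta)$ independent of $Y$. The number $\delta$ is the mismatch probability. Environment $e$ has law $P_e=P_{\delta_e}$; the target environment has law $P_{\mathrm{te}}=P_{\delta_{\mathrm{te}}}$. Encoders. $\mathcal{F}$ is the set of all functions $f:\{0,1\}^2\to\mathbb{S}^1\subset\mathbb{R}^2$ ($\mathbb{S}^1$ is the unit circle). With $\mathbf{b}_0=(1,0)^\top$, $\mathbf{b}_1=(0,1)^\top$, set $f_C(c,s)=\mathbf{b}_c$, $f_S(c,s)=\mathbf{b}_s$. Coding objective. For $f\in\mathcal{F}$ and environment $e$, let $\mathbf{M}_{e,y}(f)=\mathbb{E}_e[f(\mathbf{X})f(\mathbf{X})^\top\mid Y=y]$ and $\mathbf{M}_e(f)=\tfrac12(\mathbf{M}_{e,0}(f)+\mathbf{M}_{e,1}(f))$. For $a>0$, $$J_e(f)=\tfrac12\log\det(\mathbf{I}_2+a\mathbf{M}_e(f))-\tfrac14\sum_{y\in\{0,1\}}\log\det(\mathbf{I}_2+a\mathbf{M}_{e,y}(f)),\qquad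 J_{\mathrm{tr}}(f)=\sum_{e=1}^E w_eJ_e(f).$$ Risk. For a classifier $g:\mathbb{S}^1\to\{0,1\}$, $\mathcal{L}_e(g\circ f)=P_e(g(f(\mathbf{X}))\ne Y)$, and $\mathcal{L}_{\mathrm{te}}$ is the same with $P_{\mathrm{te}}$. A classifier $g$ is source-optimal on $f$ if it minimises $\sum_{e}w_e\mathcal{L}_e(g\circ f)$ over all classifiers. *)

(* Defs.v *)
From HB Require Import structures.
From mathcomp Require Import all_boot all_order all_algebra.
From mathcomp Require Import all_classical all_reals all_analysis.

Set Implicit Arguments.
Unset Strict Implicit.
Unset Printing Implicit Defensive.

Import Order.TTheory GRing.Theory Num.Theory.
Local Open Scope classical_set_scope.
Local Open Scope ring_scope.

(* {0,1} is bool, with exclusive or (+) = addb.  A sample is ((c, s), y). *)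
Notation input := (bool * bool)%type.
Notation sample := (input * bool)%type.

(* (Y, B) |-> ((C, S), Y) with C = Y and S = Y (+) B *)
Definition sample_of (yb : bool * bool) : sample :=
  ((yb.1, yb.1 (+) yb.2), yb.1).

Lemma measurable_bool2_fun d (T : measurableType d) (h : bool * bool -> T) :
  measurable_fun [set: bool * bool] h.
Proof.
move=> _ A _; rewrite setTI.
have -> : h @^-1` A = \bigcup_(p in h @^-1` A) ([set p.1] `*` [set p.2]).
  apply/seteqP; split=> [[y b] Ayb|[y b] [[y' b'] Ayb [/= -> ->]]] //.
  by exists (y, b).
apply: fin_bigcup_measurable => [|p _]; first exact: finite_finset.
exact: measurableX.
Qed.

HB.instance Definition _ := isMeasurableFun.Build _ _ _ _ sample_of
  (@measurable_bool2_fun _ _ sample_of).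

(* The law P_delta.  The product measure makes B independent of Y;
   bernoulli_prob delta is Bernoulli(delta) only for 0 <= delta <= 1. *)
Definition env_law (R : realType) (delta : R) :
    probability sample R :=
  distribution (bernoulli_prob (2^-1)%R \x bernoulli_prob delta)%E sample_of.

Definition circle (R : realType) : Type :=
  {v : 'cV[R]_2 | \sum_(i < 2) v i 0 ^+ 2 == 1}.

Definition encoder (R : realType) : Type := input -> circle R.

Definition bvec (R : realType) (c : bool) : 'cV[R]_2 :=
  \col_(i < 2) ((i : nat) == c)%:R.

Lemma bvec_circle (R : realType) (c : bool) :
  \sum_(i < 2) bvec R c i 0 ^+ 2 == 1.
Proof.
rewrite !big_ord_recl big_ord0 !mxE /=.
by case: c; rewrite /= ?expr0n ?expr1n ?add0r ?addr0.
Qed.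

Definition bpoint (R : realType) (c : bool) : circle R :=
  exist _ (bvec R c) (bvec_circle R c).

Definition f_C (R : realType) : encoder R := fun x => bpoint R x.1.
Definition f_S (R : realType) : encoder R := fun x => bpoint R x.2.

Section Objective.
Variables (R : realType) (P : probability sample R).

(* E[h | A] for an event A of positive probability *)
Definition cond_expectation (A : set sample) (h : sample -> R) : R :=
  (\int[P]_(u in A) h u) / fine (P A).

Definition class_moment (f : encoder R) (y : bool) : 'M[R]_2 :=
  \matrix_(i, j) cond_expectation [set u | u.2 = y]
    (fun u => (val (f u.1) *m (val (f u.1))^T) i j).

Definition moment (f : encoder R) : 'M[R]_2 :=
  2^-1 *: (class_moment f false + class_moment f true).

Definition logdet (a : R) (M : 'M[R]_2) : R := ln (\det (1%:M + a *: M)).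

Definition objective (a : R) (f : encoder R) : R :=
  2^-1 * logdet a (moment f)
  - 4^-1 * \sum_(y : bool) logdet a (class_moment f y).

Definition risk (g : circle R -> bool) (f : encoder R) : R :=
  fine (P [set u | g (f u.1) != u.2]).

End Objective.

Definition source_objective (R : realType) (E : nat) (w delta : 'I_E -> R)
    (a : R) (f : encoder R) : R :=
  \sum_(e < E) w e * objective (env_law (delta e)) a f.

Definition source_risk (R : realType) (E : nat) (w delta : 'I_E -> R)
    (g : circle R -> bool) (f : encoder R) : R :=
  \sum_(e < E) w e * risk (env_law (delta e)) g f.

Definition source_optimal (R : realType) (E : nat) (w delta : 'I_E -> R)
    (f : encoder R) (g : circle R -> bool) : Prop :=
  forall g', source_risk w delta g f <= source_risk w delta g' f.

Definition global_maximiser (R : realType) (T : Type) (J : T -> R) (x : T) :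
  Prop := forall x', J x' <= J x.

(* Main.v *)
(* With no mismatch, X = (Y, Y), so an encoder only enters through its two unit
   vectors u = f(0,0) and v = f(1,1), and the objective is
   1/2 ln (1 + a + (a/2)^2 (1 - <u,v>^2)) - 1/2 ln (1 + a), which is largest
   when u and v are orthogonal; this holds for f_C and for f_S.  A classifier
   without source error exists, so an optimal one sends b_y to y; at mismatch
   probability one, S is the negation of Y and it always errs. *)
Require Import Defs.
From mathcomp Require Import all_boot all_order all_algebra.
From mathcomp Require Import all_classical all_reals all_analysis.
From mathcomp Require Import ring lra.
Import Order.TTheory GRing.Theory Num.Theory.
Local Open Scope classical_set_scope.
Local Open Scope ring_scope.

(** Every set is a finite union of singletons, and these are measurable rectangles. *)
Lemma measurable_sample (A : set sample) : measurable A.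
Proof.
have -> : A = \bigcup_(u in A) ([set u.1.1] `*` [set u.1.2] `*` [set u.2]).
  apply/seteqP; split=> [[[c s] y] Au|[[c s] y] [[[c' s'] y'] Au]].
    by exists (c, s, y).
  by move=> [[/= -> ->] ->].
apply: fin_bigcup_measurable => [|u _]; first exact: finite_finset.
by apply: measurableX => //; exact: measurableX.
Qed.

Lemma measurable_sample_fun d (T : sigmaRingType d) (D : set sample)
  (h : sample -> T) : measurable_fun D h.
Proof. by move=> _ A _; exact: measurable_sample. Qed.

(** At mismatch probability 0 or 1 the bit B is the constant [b], so only the two values of Y remain
    as atoms, each of mass 1/2. One statement serves both source and target. *)
Lemma env_law_dirac (R : realType) (b : bool) (A : set sample) :
  env_law (b%:R : R) A =
  (2^-1 * (\1_A (sample_of (true, b)) + \1_A (sample_of (false, b))))%:E.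
Proof.
have half01 : (0 <= 2^-1 :> R) && (2^-1 <= 1 :> R) by apply/andP; split; lra.
have b01 : (0 <= b%:R :> R) && (b%:R <= 1 :> R) by case: b; rewrite /= ?lexx ?ler01.
rewrite /env_law /distribution /pushforward /= /product_measure1.
rewrite integral_bernoulli_prob// => /=; rewrite !bernoulli_probE// !diracE.
have E x y : (y \in xsection (sample_of @^-1` A) x) = (sample_of (x, y) \in A).
  by apply/idP/idP; rewrite ?inE /xsection /= ?inE.
rewrite !E !indicE /unstable.onem; case: b {b01} => /=;
  rewrite -?(EFinM,EFinD); congr (_%:E); lra.
Qed.

Lemma cond_expectation_env_law0 (R : realType) (y : bool) (h : sample -> R) :
  cond_expectation (env_law 0) [set u | u.2 = y] h = h (y, y, y).
Proof.
have PE A : env_law (0 : R) A =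
    (2^-1 * (\1_A (true, true, true) + \1_A (false, false, false)))%:E.
  exact: (env_law_dirac R false).
set D := [set u | _].
have PD : env_law (0 : R) D = (2^-1)%:E.
  rewrite PE !indicE /D; congr (_%:E).
  case: y {D} => /=.
    rewrite mem_set//= memNset//=; lra.
  rewrite memNset//= mem_set//=; lra.
rewrite /cond_expectation /Rintegral.
(* The law charges only samples with X = (Y, Y), so on [D] the integrand is almost surely constant;
   the exceptional null set is X <> (Y, Y). *)
rewrite (ae_eq_integral (cst (h (y, y, y))%:E)).
- rewrite integral_cst; last exact: measurable_sample.
  by rewrite [X in fine (_ * X)]PD PD -EFinM /= mulfK // invr_eq0 pnatr_eq0.
- exact: measurable_sample.
- exact: measurable_sample_fun.
- exact: measurable_sample_fun.
- exists [set u | u.1 <> (u.2, u.2)]; split.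
  + exact: measurable_sample.
  + by rewrite [LHS]PE !indicE !memNset ?addr0 ?mulr0 //= => /(_ erefl).
  + move=> [x z] /= /not_implyP [Dxz neq_h] xE; apply: neq_h.
    by rewrite xE; move: Dxz; rewrite /D /= => ->.
Qed.

Lemma class_moment_env_law0 (R : realType) (f : encoder R) (y : bool) :
  class_moment (env_law 0) f y = val (f (y, y)) *m (val (f (y, y)))^T.
Proof. by apply/matrixP => i j; rewrite mxE cond_expectation_env_law0. Qed.

(** The value of [delta] enters as an equation so that the hypotheses on source and target can be
    passed in directly. *)
Lemma risk_env_law (R : realType) (b : bool) (delta : R) (g : circle R -> bool)
    (f : encoder R) : delta = b%:R ->
  risk (env_law delta) g f =
  2^-1 * ((g (f (true, true (+) b)) != true)%:R +
          (g (f (false, false (+) b)) != false)%:R).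
Proof.
move=> ->; rewrite /risk env_law_dirac /= !indicE.
by congr (_ * (_ %:R + _ %:R)); congr (nat_of_bool _); apply/idP/idP; rewrite inE.
Qed.

Lemma det_mx22 (R : comNzRingType) (A : 'M[R]_2) :
  \det A = A 0 0 * A 1 1 - A 0 1 * A 1 0.
Proof.
rewrite (expand_det_row _ 0) !big_ord_recl big_ord0 /cofactor !det_mx11 !mxE /=.
have -> : lift ord0 ord0 = 1 :> 'I_2 by apply/val_inj.
have -> : lift 1 0 = 0 :> 'I_2 by apply/val_inj.
by rewrite addr0 expr0 mul1r expr1 mulN1r mulrN.
Qed.

Definition dot {R : nzRingType} {n : nat} (u v : 'cV[R]_n) : R :=
  \sum_(i < n) u i 0 * v i 0.

(** For a 2 x 2 matrix N, det(I + tN) = 1 + t tr N + t^2 det N. Here t = a/2 and N = [u v][u v]^T,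
    whose determinant is the Gram determinant of u and v. *)
Lemma det_add_half_gram2 (R : realFieldType) (a : R) (u v : 'cV[R]_2) :
  \det (1%:M + a *: (2^-1 *: (u *m u^T + v *m v^T))) =
  1 + a / 2 * (dot u u + dot v v) +
  (a / 2) ^+ 2 * (dot u u * dot v v - dot u v ^+ 2).
Proof.
have one : lift ord0 ord0 = 1 :> 'I_2 by apply/val_inj.
rewrite det_mx22 /dot !big_ord_recl !big_ord0 !mxE !big_ord_recl !big_ord0 !mxE /=.
by rewrite one; field.
Qed.

Lemma det_add_gram1 (R : realFieldType) (a : R) (u : 'cV[R]_2) :
  \det (1%:M + a *: (u *m u^T)) = 1 + a * dot u u.
Proof.
(* The case u = v of the previous formula, where the Gram determinant vanishes. *)
have -> : u *m u^T = 2^-1 *: (u *m u^T + u *m u^T).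
  by rewrite -mulr2n -scaler_nat scalerA mulVf ?pnatr_eq0 // scale1r.
rewrite det_add_half_gram2; by field.
Qed.

(** Lagrange's identity in the plane; it yields Cauchy-Schwarz, since the right side is a square. *)
Lemma lagrange2 {R : comNzRingType} (u v : 'cV[R]_2) :
  dot u u * dot v v - dot u v ^+ 2 = (u 0 0 * v 1 0 - u 1 0 * v 0 0) ^+ 2.
Proof.
have one : lift ord0 ord0 = 1 :> 'I_2 by apply/val_inj.
by rewrite /dot !big_ord_recl !big_ord0 one; ring.
Qed.

Lemma dot_circle {R : realType} (p : circle R) : dot (val p) (val p) = 1.
Proof. by rewrite /dot; under eq_bigr do rewrite -expr2; exact/eqP/(valP p). Qed.

Lemma objective_env_law0 (R : realType) (a : R) (f : encoder R) :
  objective (env_law 0) a f =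
  2^-1 * ln (1 + a + (a / 2) ^+ 2 *
     (1 - dot (val (f (false, false))) (val (f (true, true))) ^+ 2)) -
  2^-1 * ln (1 + a).
Proof.
rewrite /objective /moment /logdet big_bool /= !class_moment_env_law0.
rewrite det_add_half_gram2 !det_add_gram1 !dot_circle.
rewrite !mulr1 mulrDr; congr (2^-1 * ln _ - _); by field.
Qed.

Lemma dot_bpoint (R : realType) : dot (val (bpoint R false)) (val (bpoint R true)) = 0.
Proof. by rewrite /dot !big_ord_recl big_ord0 !mxE /= mulr0 mul0r !addr0. Qed.

Lemma orthogonal_maximises_objective (R : realType) (a : R) (f f' : encoder R) :
  0 < a -> dot (val (f (false, false))) (val (f (true, true))) = 0 ->
  objective (env_law 0) a f' <= objective (env_law 0) a f.
Proof.
move=> a0 ortho; rewrite !objective_env_law0 ortho.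
set d := dot _ _.
have d1 : 0 <= 1 - d ^+ 2.
  have := lagrange2 (val (f' (false, false))) (val (f' (true, true))).
  rewrite !dot_circle mulr1 => ->; exact: sqr_ge0.
have d2 := sqr_ge0 d; have q0 := sqr_ge0 (a / 2).
(* Monotonicity of [ln] leaves 1 - d^2 <= 1, together with positivity of both arguments. *)
rewrite lerD2r ler_pM2l ?invr_gt0 ?ltr0n // ler_ln ?posrE.
- by rewrite lerD2l ler_wpM2l // expr0n subr0 lerBlDr lerDl.
- by rewrite ltr_wpDr ?mulr_ge0 //; lra.
- by rewrite ltr_wpDr ?mulr_ge0 ?expr0n ?subr0 ?ler01 //; lra.
Qed.

(** Of the two basis vectors, b_1 = (0, 1) is the one whose first coordinate is zero. *)
Definition decode {R : realType} (p : circle R) : bool := val p 0 0 == 0.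

Lemma decode_bpoint (R : realType) (c : bool) : decode (bpoint R c) = c.
Proof. by rewrite /decode mxE; case: c; rewrite /= ?eqxx ?oner_eq0. Qed.

Theorem mainTheorem3 (R : realType) (a : R) (E : nat) (w delta : 'I_E -> R)
    (delta_te : R) (a_gt0 : 0 < a)
    (w_gt0 : forall e, 0 < w e) (w_sum1 : \sum_(e < E) w e = 1)
    (delta0 : forall e, delta e = 0) (delta_te1 : delta_te = 1) :
  global_maximiser (source_objective w delta a) (f_C R) /\
  global_maximiser (source_objective w delta a) (f_S R) /\
  (exists g, source_optimal w delta (f_S R) g) /\
  (forall g, source_optimal w delta (f_S R) g ->
    risk (env_law delta_te) g (f_S R) = 1).
Proof.
have max f : dot (val (f (false, false))) (val (f (true, true))) = 0 ->
    global_maximiser (source_objective w delta a) f.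
  move=> ortho f'; apply: ler_sum => e _.
  rewrite delta0; apply: ler_wpM2l; first exact: ltW.
  exact: orthogonal_maximises_objective.
have riskE g : source_risk w delta g (f_S R) =
    2^-1 * ((g (bpoint R true) != true)%:R + (g (bpoint R false) != false)%:R).
  rewrite /source_risk; under eq_bigr => e _ do rewrite (risk_env_law _ false _ _ _ (delta0 e)).
  by rewrite -mulr_suml w_sum1 mul1r.
have decode0 : source_risk w delta (@decode R) (f_S R) = 0.
  by rewrite riskE !decode_bpoint !eqxx addr0 mulr0.
split; first by apply: max; exact: dot_bpoint.
split; first by apply: max; exact: dot_bpoint.
split.
  (* Source risks are nonnegative and [decode] attains zero. *)
  exists (@decode R) => g'; rewrite decode0 riskE.
  by rewrite mulr_ge0 ?addr_ge0 ?invr_ge0 ?ler0n.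
move=> g /(_ (@decode R)); rewrite decode0 riskE (risk_env_law _ true _ _ _ delta_te1) /=.
rewrite /f_S /=.
(* Only g(b_1) = 1, g(b_0) = 0 is consistent with zero source risk [h]; both target atoms then err,
   giving (1 + 1)/2 = 1. *)
by case: (g _); case: (g _) => /= h; lra.
Qed.
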